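(* Let $m,n\ge2$ be integers with $m$ even, let $c_0,c_1,\dots,c_{n-1}\in\mathbb{R}$, and let $\mathcal{A}$ be the real $m$th order $n$-dimensional circulant tensor whose root tensor $\mathcal{A}_1=(\alpha_{j_1\cdots j_{m-1}})$ is diagonal with $\alpha_{j_1\cdots j_{m-1}}=c_{j-1}$ if $j_1=\cdots=j_{m-1}=j$, and $\alpha_{j_1\cdots j_{m-1}}=0$ otherwise. Let $\mathbf{c}=(c_1,\dots,c_{n-1})^\top$, and consider the condition $$(\ast)\qquad c_0\ge\sum_{j=1}^{n-1}|c_j|.$$ Then: (a) If $\mathcal{A}$ is positive semi-definite, then $c_0\ge0$ and $\lambda_0(\mathcal{A})\ge0$. If furthermore $n$ is even, then $\lambda_{n/2}(\mathcal{A})\ge0$. (b) If $(\ast)$ holds, then $\mathcal{A}$ is positive semi-definite. (c) If $\mathbf{c}$ is non-positive (all entries $\le 0$), then $\mathcal{A}$ is positive semi-definite if and only if $(\ast)$ holds. (d) If $n=2pk$ for some positive integers $p$ and $k$, and $\mathbf{c}$ is $k$-alternative, then $\mathcal{A}$ is positive semi-definite if and only if $(\ast)$ holds.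
   Context: Write $[n]=\{1,\dots,n\}$. A real $m$th order $n$-dimensional tensor is an array $\mathcal{A}=(a_{j_1\cdots j_m})$ of real numbers indexed by $[n]^m$. It is circulant if $a_{j_1\cdots j_m}=a_{k_1\cdots k_m}$ whenever $j_l,k_l\in[n]$ and $k_l\equiv j_l+1 \pmod n$ for all $l\in[m]$. The root tensor of a circulant tensor is the order $m-1$ tensor with entries $\alpha_{j_1\cdots j_{m-1}}=a_{1j_1\cdots j_{m-1}}$; it determines $\mathcal{A}$. For even $m$, $\mathcal{A}$ is positive semi-definite if $\mathcal{A}\mathbf{x}^m=\sum_{j_1,\dots,j_m=1}^n a_{j_1\cdots j_m}x_{j_1}\cdots x_{j_m}\ge0$ for all $\mathbf{x}\in\mathbb{R}^n$. For a circulant tensor, $\lambda_0(\mathcal{A})=\sum_{j_1,\dots,j_{m-1}=1}^n\alpha_{j_1\cdots j_{m-1}}$ and, for even $n$, $\lambda_{n/2}(\mathcal{A})=\sum_{j_1,\dots,j_{m-1}=1}^n\alpha_{j_1\cdots j_{m-1}}(-1)^{j_1+\cdots+j_{m-1}-m+1}$. In the present diagonal-root situation with $m$ even, $\lambda_0(\mathcal{A})=\sum_{j=0}^{n-1}c_j$ and $\lambda_{n/2}(\mathcal{A})=\sum_{j=0}^{n-1}(-1)^jc_j$. For a positive integer $k\le n/2$, the vector $\mathbf{c}=(c_1,\dots,c_{n-1})^\top$ is called $k$-alternative if $n=2pk$ for some integer $p$, $c_{(2q-1)k}\ge0$ for $q\in\{1,\dots,p\}$, $c_{2qk}\le0$ for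 $q\in\{1,\dots,p-1\}$, and $c_j=0$ for all other $j\in[n-1]$. *)

(* Defs.v *)
From HB Require Import structures.
From mathcomp Require Import all_boot all_order all_algebra.
From mathcomp Require Import reals.

Set Implicit Arguments.
Unset Strict Implicit.
Unset Printing Implicit Defensive.

Import Order.TTheory GRing.Theory Num.Theory.
Local Open Scope ring_scope.

(* The index set [n] = {1, ..., n} is 'I_n = {0, ..., n-1}:    *)
(* the tensor index j_l is stored as j_l - 1. The indices of c_0, ..., c_(n-1) *)
(* are not shifted.                                                           *)

Definition tensor (R : realType) (m n : nat) := {ffun m.-tuple 'I_n -> R}.

Definition circulant (R : realType) (m n : nat) (A : tensor R m n) : Prop :=
  forall j k : m.-tuple 'I_n,
    (forall l : 'I_m, tnth k l = (tnth j l).+1 %[mod n]) -> A j = A k.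

Definition root_tensor (R : realType) (m n : nat) (A : tensor R m.+1 n.+1) :
    tensor R m n.+1 :=
  [ffun j : m.-tuple 'I_n.+1 => A [tuple of ord0 :: j]].

Definition diagonal_with (R : realType) (m n : nat) (T : tensor R m n)
    (d : 'I_n -> R) : Prop :=
  (forall i : 'I_n, T (nseq_tuple m i) = d i) /\
  (forall j : m.-tuple 'I_n, ~~ constant j -> T j = 0).

Definition tensor_form (R : realType) (m n : nat) (A : tensor R m n)
    (x : 'rV[R]_n) : R :=
  \sum_(j : m.-tuple 'I_n) A j * \prod_(l < m) x 0 (tnth j l).

(* Only meant for even m. *)
Definition psd (R : realType) (m n : nat) (A : tensor R m n) : Prop :=
  forall x : 'rV[R]_n, 0 <= tensor_form A x.

Definition lambda0 (R : realType) (m n : nat) (A : tensor R m.+1 n.+1) : R :=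
  \sum_(j : m.-tuple 'I_n.+1) root_tensor A j.

(* lambda_(n/2), meant for even dimension. For an order M = m.+1 tensor the    *)
(* exponent j_1 + ... + j_(M-1) - M + 1 is the sum of the M - 1 shifted        *)
(* indices.                                                                   *)
Definition lambda_half (R : realType) (m n : nat) (A : tensor R m.+1 n.+1) : R :=
  \sum_(j : m.-tuple 'I_n.+1)
    root_tensor A j * (-1) ^+ (\sum_(l < m) (tnth j l : nat))%N.

(* The next three predicates concern (c_1, ..., c_(n-1)), possibly compared to *)
(* c_0; the family c also carries c_0, whence the conditions 0 < j.            *)

Definition dominant (R : realType) (n : nat) (c : 'I_n.+1 -> R) : Prop :=
  \sum_(j < n.+1 | (0 < j)%N) `|c j| <= c ord0.

Definition nonpositive_tail (R : realType) (n : nat) (c : 'I_n -> R) : Prop :=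
  forall j : 'I_n, (0 < j)%N -> c j <= 0.

Definition k_alternative (R : realType) (n k : nat) (c : 'I_n -> R) : Prop :=
  [/\ (0 < k)%N, (2 * k <= n)%N &
   exists p : nat,
   [/\ n = (2 * p * k)%N,
       forall (q : nat) (j : 'I_n), (1 <= q <= p)%N ->
         j = ((2 * q - 1) * k)%N :> nat -> 0 <= c j,
       forall (q : nat) (j : 'I_n), (1 <= q <= p - 1)%N ->
         j = (2 * q * k)%N :> nat -> c j <= 0 &
       forall j : 'I_n, (0 < j)%N ->
         (forall q : nat, (1 <= q <= p)%N -> j <> ((2 * q - 1) * k)%N :> nat) ->
         (forall q : nat, (1 <= q <= p - 1)%N -> j <> (2 * q * k)%N :> nat) ->
         c j = 0]].

(* Main.v *)
(* Circulancy turns the form into sum_(i,j) c_j x_i x_(i+j)^m, the tensor having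
   order m + 1. The necessary conditions come from testing it on e_0, on the
   all-one vector, and on the vector of signs alternating between blocks of k
   consecutive coordinates. At the last two, the form equals the dimension times
   a signed sum of the c_j, namely c_0 - sum_(j > 0) |c_j| when c is non-positive,
   respectively k-alternative. Sufficiency of dominance is Young's inequality
   (m + 1) a b^m <= a^(m+1) + m b^(m+1), summed over cyclic shifts. *)

Require Import Defs.
From HB Require Import structures.
From mathcomp Require Import all_boot all_order all_algebra.
From mathcomp Require Import reals.
From mathcomp Require Import lra zify.

Set Implicit Arguments.
Unset Strict Implicit.
Unset Printing Implicit Defensive.

Import Order.TTheory GRing.Theory Num.Theory.
Local Open Scope ring_scope.

Lemma sum_tuple_cons (V : nmodType) (T : finType) (m : nat)
    (F : m.+1.-tuple T -> V) :
  \sum_t F t = \sum_(i : T) \sum_(t : m.-tuple T) F [tuple of i :: t].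
Proof.
rewrite pair_big /= (reindex (fun p : T * m.-tuple T => [tuple of p.1 :: p.2])) //.
exists (fun t => (thead t, [tuple of behead t])) => [[i t]|t] _ /=.
  by congr pair; apply: val_inj.
by rewrite -tuple_eta.
Qed.

Lemma constant_tupleP (T : eqType) (m : nat) (t : m.+1.-tuple T) :
  constant t -> t = nseq_tuple m.+1 (thead t).
Proof.
case/tupleP: t => x t ct; apply: val_inj.
by move/all_pred1P: ct; rewrite theadE /= size_tuple => ->.
Qed.

Lemma constant_nseq_tuple (T : eqType) (m : nat) (x : T) :
  constant (nseq_tuple m x).
Proof. by case: m => //= m; rewrite all_pred1_nseq. Qed.

(** The order is written [m.+1] because a constant tuple determines its value only when it is
    nonempty; then constant tuples correspond bijectively to indices. *)
Lemma sum_diagonal (R : realType) (m n : nat) (T : tensor R m.+1 n)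
    (d : 'I_n -> R) (F : m.+1.-tuple 'I_n -> R) :
  diagonal_with T d ->
  \sum_t T t * F t = \sum_j d j * F (nseq_tuple m.+1 j).
Proof.
case=> Td T0; rewrite (bigID (fun t : m.+1.-tuple 'I_n => constant t)) /=.
rewrite [X in _ + X]big1 ?addr0; last by move=> t /T0 ->; rewrite mul0r.
rewrite (reindex_onto (fun j => nseq_tuple m.+1 j) (fun t => thead t)); last first.
  by move=> t /constant_tupleP <-.
apply: eq_big => [j|j _]; last by rewrite Td.
by rewrite /thead tnth_nseq eqxx andbT constant_nseq_tuple.
Qed.

Lemma iter_ordS (n a : nat) (u : 'I_n.+1) :
  iter a (@ordS n.+1) u = u + inZp a.
Proof.
elim: a => [|a IH]; apply: val_inj => /=; first by rewrite mod0n addn0 modn_small.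
by rewrite IH /= !modnDmr -[(_ %% _).+1]addn1 modnDml addn1 addnS.
Qed.

(** Circulancy is invariance under applying [ordS] to every index at once; iterating it [i] times
    yields translation by [i]. *)
Lemma circulant_shift (R : realType) (m n : nat) (A : tensor R m n.+1)
    (i : 'I_n.+1) (t : m.-tuple 'I_n.+1) :
  circulant A -> A (map_tuple (fun u => u + i) t) = A t.
Proof.
move=> circA.
have shift1 s : A (map_tuple (@ordS n.+1) s) = A s.
  by symmetry; apply: circA => l; rewrite tnth_map /= modn_mod.
have shift a : A (map_tuple (iter a (@ordS n.+1)) t) = A t.
  elim: a => [|a IH]; first by congr (A _); apply: val_inj; rewrite /= map_id.
  by rewrite -[RHS]IH -[RHS]shift1; congr (A _); apply: val_inj; rewrite /= -map_comp.
rewrite -(shift i); congr (A _); apply: val_inj => /=; apply: eq_map => u.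
by rewrite iter_ordS valZpK.
Qed.

(** Fix the first index i and translate the others by i. Invariance under translation turns the
    entry into one of the root tensor, whose diagonality leaves a single term for each j. *)
Lemma tensor_form_circulant (R : realType) (m n : nat)
    (A : tensor R m.+2 n.+1) (c : 'I_n.+1 -> R) (x : 'rV[R]_n.+1) :
  circulant A -> diagonal_with (root_tensor A) c ->
  tensor_form A x
    = \sum_i \sum_j c j * (x 0 i * x 0 (i + j) ^+ m.+1).
Proof.
move=> circA rootA; rewrite /tensor_form sum_tuple_cons; apply: eq_bigr => i _.
rewrite (reindex (map_tuple (fun u : 'I_n.+1 => u + i))) /=; last first.
  exists (map_tuple (fun u : 'I_n.+1 => u - i)) => t _;
    by apply: val_inj; rewrite /= -map_comp map_id_in // => u _ /=; rewrite ?addrK ?subrK.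
pose F (t : m.+1.-tuple 'I_n.+1) := x 0 i * \prod_(l < m.+1) x 0 (tnth t l + i).
transitivity (\sum_t root_tensor A t * F t).
  apply: eq_bigr => t _; rewrite big_ord_recl ffunE -[in RHS](circulant_shift i _ circA).
  congr (A _ * (x 0 _ * _)); first by apply: val_inj; rewrite /= add0r.
  apply: eq_bigr => l _; congr (x 0 _).
  by rewrite -(tnth_map (fun u : 'I_n.+1 => u + i)) !(tnth_nth ord0).
rewrite (sum_diagonal _ rootA); apply: eq_bigr => j _; congr (_ * (_ * _)).
rewrite (eq_bigr (fun=> x 0 (i + j))) ?prodr_const ?card_ord // => l _.
by rewrite tnth_nseq addrC.
Qed.

(** Induction on [m]: multiply the previous inequality by b and add (a - b)(a^(m+1) - b^(m+1)) >= 0,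
    which holds because powers are monotone on nonnegative numbers. *)
Lemma young_exp (R : realFieldType) (m : nat) (a b : R) :
  0 <= a -> 0 <= b -> m.+1%:R * (a * b ^+ m) <= a ^+ m.+1 + m%:R * b ^+ m.+1.
Proof.
move=> a0 b0; elim: m => [|m IH]; first by rewrite expr0 expr1 mul0r addr0 mulr1 mul1r.
have rearr : 0 <= (a - b) * (a ^+ m.+1 - b ^+ m.+1).
  have [ab|/ltW ba] := leP a b.
    by rewrite mulr_le0 // subr_le0 // lerXn2r.
  by rewrite mulr_ge0 // subr_ge0 // lerXn2r.
have := ler_wpM2l b0 IH; move: rearr.
rewrite -[m.+2%:R]natr1 -[m.+1%:R]natr1 !exprS; set p := a ^+ m; set q := b ^+ m.
move=> h1 h2; lra.
Qed.

Lemma cyclic_sum_le (R : realType) (m n : nat) (x : 'I_n.+1 -> R) (j : 'I_n.+1) :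
  \sum_i `|x i * x (i + j) ^+ m| <= \sum_i `|x i| ^+ m.+1.
Proof.
have shift : \sum_i `|x (i + j)| ^+ m.+1 = \sum_i `|x i| ^+ m.+1.
  rewrite [RHS](reindex (fun i => i + j)) //.
  by exists (fun i => i - j) => i _; rewrite ?addrK ?subrK.
(* Shift invariance splits the right side into weights 1 and m on the unshifted and shifted sums, so
   that Young's inequality applies term by term. *)
have -> : \sum_i `|x i| ^+ m.+1 = m.+1%:R^-1 *
    \sum_i (`|x i| ^+ m.+1 + m%:R * `|x (i + j)| ^+ m.+1).
  rewrite big_split /= -mulr_sumr shift -[X in X + _]mul1r -mulrDl nat1r.
  by rewrite mulKf // pnatr_eq0.
rewrite ler_pdivlMl ?ltr0Sn // mulr_sumr.
by apply: ler_sum => i _; rewrite normrM normrX young_exp.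
Qed.

Lemma sum_ord0_tail (R : realType) (n : nat) (F : 'I_n.+1 -> R) :
  \sum_j F j = F ord0 + \sum_(j < n.+1 | (0 < j)%N) F j.
Proof.
by rewrite (bigD1 ord0) //=; congr (_ + _); apply: eq_bigl => j; rewrite lt0n.
Qed.

Lemma dominant_signed_sum (R : realType) (n : nat) (c s : 'I_n.+1 -> R) :
  s ord0 = 1 -> (forall j : 'I_n.+1, (0 < j)%N -> c j * s j = - `|c j|) ->
  dominant c <-> 0 <= \sum_j c j * s j.
Proof.
move=> s0 sE; rewrite sum_ord0_tail s0 mulr1 (eq_bigr _ sE) sumrN subr_ge0.
by [].
Qed.

Section DiagonalRoot.

Variables (R : realType) (m n : nat) (A : tensor R m.+2 n.+1) (c : 'I_n.+1 -> R).
Hypotheses (A_circ : circulant A) (A_root : diagonal_with (root_tensor A) c).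

Lemma lambda0_diagonal : lambda0 A = \sum_j c j.
Proof.
rewrite /lambda0; under eq_bigr do rewrite -[root_tensor _ _]mulr1.
by rewrite (sum_diagonal (fun=> 1) A_root); apply: eq_bigr => j _; rewrite mulr1.
Qed.

(** On a constant tuple the exponent is (m+1) j, which has the parity of j. *)
Lemma lambda_half_diagonal : odd m.+1 -> lambda_half A = \sum_j c j * (-1) ^+ j.
Proof.
move=> modd; rewrite /lambda_half (sum_diagonal _ A_root).
apply: eq_bigr => j _; congr (_ * _); rewrite -[LHS]signr_odd -[RHS]signr_odd.
under eq_bigr do rewrite tnth_nseq.
by rewrite sum_nat_const card_ord oddM modd.
Qed.

(** Here [x] is the test vector. The factor [c j] on both sides of the hypothesis means that the
    product need be independent of i only where [c j] is nonzero, which for block signs will be at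
    multiples of k. *)
Lemma psd_signed_sum (x s : 'I_n.+1 -> R) :
  (forall i j, c j * (x i * x (i + j) ^+ m.+1) = c j * s j) ->
  psd A -> 0 <= \sum_j c j * s j.
Proof.
move=> xs /(_ (\row_i x i)); rewrite (tensor_form_circulant _ A_circ A_root).
under eq_bigr do under eq_bigr do rewrite !mxE xs.
by rewrite sumr_const card_ord pmulrn_lge0.
Qed.

Lemma psd_sum_ge0 : psd A -> 0 <= \sum_j c j.
Proof.
move/(@psd_signed_sum (fun=> 1) (fun=> 1)); under eq_bigr do rewrite mulr1.
by apply=> i j; rewrite expr1n mul1r.
Qed.

Lemma psd_ord0_ge0 : psd A -> 0 <= c ord0.
Proof.
move=> /(_ (\row_i (i == ord0)%:R)); rewrite (tensor_form_circulant _ A_circ A_root).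
rewrite (bigD1 ord0) //= [X in _ + X]big1 ?addr0; last first.
  by move=> i /negPf i0; apply: big1 => j _; rewrite !mxE i0 mul0r mulr0.
rewrite (bigD1 ord0) //= [X in _ + X]big1 ?addr0; last first.
  by move=> j /negPf j0; rewrite !mxE add0r j0 expr0n /= !mulr0.
by rewrite !mxE eqxx expr1n !mulr1.
Qed.

(* The sign vector (-1)^(i %/ k) is well defined on residues mod n since the
   number 2p of blocks is even. *)
Lemma psd_block_sign_sum (p k : nat) :
  odd m.+1 -> (0 < k)%N -> n.+1 = (2 * p * k)%N ->
  (forall j : 'I_n.+1, ~~ (k %| j)%N -> c j = 0) ->
  psd A -> 0 <= \sum_j c j * (-1) ^+ (j %/ k)%N.
Proof.
move=> modd k0 nE cE; apply: (@psd_signed_sum (fun i => (-1) ^+ (i %/ k)%N)) => i j.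
have [/dvdnP[q jE]|/cE ->] := boolP (k %| j)%N; last by rewrite !mul0r.
congr (_ * _); rewrite -exprM -exprD -[LHS]signr_odd -[RHS]signr_odd; congr (_ ^+ _).
(* The odd power does not affect the sign, so with j = q k it remains to see that the block numbers
   of i and i + j differ by q modulo 2. *)
rewrite oddD oddM modd andbT jE mulnK //=; congr nat_of_bool.
have blocks : ((i + j) %/ k = i %/ k + q)%N by rewrite jE addnC divnMDl // addnC.
have [lt_ij|ge_ij] := ltnP (i + j)%N n.+1.
  by rewrite modn_small // blocks oddD addKb.
set r := (i + j - n.+1)%N; have ijE : (i + j = 2 * p * k + r)%N by rewrite -nE subnKC.
have -> : ((i + j) %% n.+1 = r)%N.
  rewrite ijE -nE modnDl modn_small //.
  by have := ltn_ord i; have := ltn_ord j; rewrite /r; lia.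
have : ((i + j) %/ k = 2 * p + r %/ k)%N by rewrite ijE divnMDl.
rewrite blocks => /(congr1 odd); rewrite mul2n !oddD odd_double /= => <-.
by rewrite addKb.
Qed.

Lemma dominant_psd : odd m.+1 -> dominant c -> psd A.
Proof.
move=> modd dom x; rewrite (tensor_form_circulant _ A_circ A_root).
rewrite exchange_big /= sum_ord0_tail.
set S := \sum_i `|x 0 i| ^+ m.+2.
have S0 : 0 <= S by apply: sumr_ge0 => i _; apply: exprn_ge0.
(* The term j = 0 is exactly c_0 S since m + 2 is even; every other term will be at least -|c_j|
   S. *)
have -> : \sum_i c ord0 * (x 0 i * x 0 (i + ord0) ^+ m.+1) = c ord0 * S.
  rewrite -mulr_sumr; congr (_ * _); apply: eq_bigr => i _.
  by rewrite addr0 -exprS -normrX ger0_norm // exprn_even_ge0 //= negbK.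
apply: le_trans (_ : c ord0 * S - (\sum_(j < n.+1 | (0 < j)%N) `|c j|) * S <= _).
  by rewrite -mulrBl mulr_ge0 // subr_ge0.
rewrite lerD2l mulr_suml -sumrN; apply: ler_sum => j _.
rewrite -mulr_sumr lerNl -mulNr.
apply: le_trans (ler_norm _) _; rewrite normrM normrN ler_wpM2l //.
exact: le_trans (ler_norm_sum _ _ _) (cyclic_sum_le _ (x 0) j).
Qed.

Lemma psd_nonpositive_tail :
  nonpositive_tail c -> psd A -> dominant c.
Proof.
move=> cneg /psd_sum_ge0 h; apply/(@dominant_signed_sum _ _ _ (fun=> 1)) => //.
  by move=> j /cneg cj; rewrite mulr1 ler0_norm ?opprK.
by under eq_bigr do rewrite mulr1.
Qed.

Lemma psd_k_alternative (k : nat) :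
  odd m.+1 -> k_alternative k c -> psd A -> dominant c.
Proof.
move=> modd [k0 _ [p [nE codd ceven c0]]] psdA.
have cE (j : 'I_n.+1) : ~~ (k %| j)%N -> c j = 0.
  move=> kj; have j0 : (0 < j)%N by case: (posnP j) kj => // ->; rewrite dvdn0.
  by apply: c0 => // q _ jE; rewrite jE dvdn_mull in kj.
apply/(@dominant_signed_sum _ _ _ (fun j : 'I_n.+1 => (-1) ^+ (j %/ k)%N)).
- by rewrite div0n.
- move=> j j0.
  have [/dvdnP[r jE]|/cE ->] := boolP (k %| j)%N; last by rewrite normr0 oppr0 mul0r.
  have r0 : (0 < r)%N by move: j0; rewrite jE muln_gt0 => /andP[].
  have rp : (r < 2 * p)%N by rewrite -(ltn_pmul2r k0) -nE -jE.
  (* An odd r is 2q - 1 with q = [r./2.+1], an even r is 2q with q = [r./2]; the bounds 0 < r < 2p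
     put q in the range where the sign of [c j] is prescribed. *)
  rewrite jE mulnK // -signr_odd; case: (boolP (odd r)) => r_odd.
    have cj : 0 <= c j.
      by apply: (codd r./2.+1); [lia | rewrite jE; congr (_ * _)%N; lia].
    by rewrite ger0_norm // mulrN1.
  have cj : c j <= 0.
    by apply: (ceven r./2); [lia | rewrite jE; congr (_ * _)%N; lia].
  by rewrite ler0_norm // opprK mulr1.
- exact: psd_block_sign_sum modd k0 nE cE psdA.
Qed.

End DiagonalRoot.

Theorem theorem7 (R : realType) (m n : nat)
    (hm : (2 <= m.+1)%N) (hn : (2 <= n.+1)%N) (m_even : ~~ odd m.+1)
    (c : 'I_n.+1 -> R) (A : tensor R m.+1 n.+1)
    (A_circ : circulant A) (A_root : diagonal_with (root_tensor A) c) :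
  [/\ psd A ->
        [/\ 0 <= c ord0, 0 <= lambda0 A &
            (~~ odd n.+1 -> 0 <= lambda_half A)],
      dominant c -> psd A,
      nonpositive_tail c -> (psd A <-> dominant c) &
      forall p k : nat, (0 < p)%N -> (0 < k)%N -> n.+1 = (2 * p * k)%N ->
        k_alternative k c -> (psd A <-> dominant c)].
Proof.
have modd : odd m by rewrite -[odd m]negbK.
(* An odd [m] is nonzero, so the root tensor has positive order and the order of [A] takes the form
   [m.+2]. *)
case: m modd {hm m_even} A A_circ A_root => // {}m modd {}A circA rootA.
have dom_psd := dominant_psd circA rootA modd.
split=> [psdA | // | cneg | p k _ _ _ calt].
- split; first exact: psd_ord0_ge0 circA rootA psdA.
    by rewrite (lambda0_diagonal rootA) (psd_sum_ge0 circA rootA).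
  move=> n_even; rewrite (lambda_half_diagonal rootA modd).
  (* Blocks of length k = 1 give the alternating vector, with p half the dimension; divisibility by
     1 puts no restriction on c. *)
  have nE : n.+1 = (2 * n.+1./2 * 1)%N by lia.
  have := psd_block_sign_sum circA rootA modd (ltn0Sn 0) nE.
  by under eq_bigr do rewrite divn1; apply=> // j; rewrite dvd1n.
- by split=> //; exact: psd_nonpositive_tail circA rootA cneg.
- by split=> //; exact: (psd_k_alternative circA rootA modd calt).
Qed.
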